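(* Let $0<q<1$ and let $x^*=\frac12 i\log q$, where $i=\sqrt{-1}$. Then \[\int_{-x^*}^{x^*}\log\vartheta_4(x,q)\,dx=i\left[\zeta(2)-\log q\,\log\sum_{n=0}^\infty P(n)q^{2n}\right],\] where $\vartheta_4$ is the fourth Jacobi theta function, $P(n)$ is the partition function, $\zeta$ is the Riemann zeta function, and the integral is taken along the straight segment of the imaginary axis from $-x^*$ to $x^*$.
   Context: For $0<q<1$ and complex $x$, the fourth Jacobi theta function is \[\vartheta_4(x,q)=\sum_{n=-\infty}^\infty(-1)^nq^{n^2}e^{2nix}.\] $P(n)$ denotes the number of partitions of the natural number $n$, with $P(0)=1$. The points $\pm x^*$ are the zeros of $\vartheta_4(\cdot,q)$ on the imaginary axis closest to the origin. On the open segment between them $\vartheta_4$ is real and positive, and $\log$ is the real logarithm. *)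

(* Defs.v *)
(* Stdlib reals with Coquelicot for the analysis; MathComp boot only to count
   partitions. *)
From mathcomp Require Import all_boot.
From Stdlib Require Import Reals ZArith Lra.
From Coquelicot Require Import Coquelicot.

Set Implicit Arguments.
Unset Strict Implicit.
Unset Printing Implicit Defensive.

Open Scope R_scope.

(* Coquelicot has no complex exponential; Euler's formula. *)
Definition Cexp (z : C) : C := (exp (Re z) * cos (Im z), exp (Re z) * sin (Im z)).

(* The sum of a convergent complex series, see [is_series_CSeries]; unspecified
   if the series diverges. *)
Definition CSeries (a : nat -> C) : C :=
  (Series (fun n => Re (a n)), Series (fun n => Im (a n))).

Lemma is_series_CSeries (a : nat -> C) (l : C) :
  is_series (V := C_R_NormedModule) a l -> CSeries a = l.
Proof.
move=> Ha.
have Hsum n : sum_n (a : nat -> C_R_NormedModule) n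
    = (sum_n (fun k => Re (a k)) n, sum_n (fun k => Im (a k)) n).
  elim: n => [|n IHn]; first by rewrite !sum_O; case: (a O).
  by rewrite !sum_Sn IHn.
have Hfst : is_series (fun n => Re (a n)) (fst l).
  have := filterlim_comp _ _ _ _ fst _ _ _ Ha (continuous_fst (fst l) (snd l)).
  by apply: filterlim_ext => n; rewrite Hsum.
have Hsnd : is_series (fun n => Im (a n)) (snd l).
  have := filterlim_comp _ _ _ _ snd _ _ _ Ha (continuous_snd (fst l) (snd l)).
  by apply: filterlim_ext => n; rewrite Hsum.
by rewrite /CSeries (is_series_unique _ _ Hfst) (is_series_unique _ _ Hsnd); case: (l).
Qed.

(* Sum over all integers of an absolutely convergent family. *)
Definition CSeriesZ (a : Z -> C) : C :=
  Cplus (CSeries (fun n => a (Z.of_nat n)))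
        (CSeries (fun n => a (- Z.of_nat n.+1)%Z)).

Definition theta4_term (x : C) (q : R) (n : Z) : C :=
  (RtoC (powerRZ (-1) n) * RtoC (powerRZ q (n * n)) *
   Cexp (RtoC 2 * RtoC (IZR n) * Ci * x))%C.

Definition theta4 (x : C) (q : R) : C := CSeriesZ (theta4_term x q).

(* On the imaginary axis theta4 is real-valued, so that its real logarithm is
   [ln (Re (theta4 x q))] wherever it is positive. *)
Lemma theta4_imaginary_real (t q : R) : Im (theta4 (Ci * RtoC t)%C q) = 0.
Proof.
have H0 (n : Z) : Im (theta4_term (Ci * RtoC t)%C q n) = 0.
  rewrite /theta4_term /Cexp; set z := Cmult _ (Cmult Ci _).
  have -> : Im z = 0 by rewrite /z /=; ring.
  by rewrite sin_0 /=; ring.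
have HS (u : nat -> R) : (forall n, u n = 0) -> Series u = 0.
  move=> Hu; rewrite (Series_ext _ (fun n => 0 * u n)); last first.
    by move=> n; rewrite Hu Rmult_0_l.
  by rewrite Series_scal_l Rmult_0_l.
change (Series (fun n => Im (theta4_term (Ci * RtoC t)%C q (Z.of_nat n))) +
  Series (fun n => Im (theta4_term (Ci * RtoC t)%C q (- Z.of_nat n.+1)%Z)) = 0).
by rewrite !HS ?Rplus_0_r // => n; apply: H0.
Qed.

(* The Dirichlet series of the Riemann zeta function, for Re s > 1, with
   k^(-s) = exp (- s ln k) and k = n + 1. *)
Definition zeta (s : C) : C :=
  CSeries (fun n => Cexp (- s * RtoC (ln (INR n.+1)))%C).

(* The number of weakly decreasing finite sequences of positive integers with
   sum n. Such a sequence has at most n terms, each at most n. *)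
Definition P (n : nat) : nat :=
  #|[set s : n.-bseq 'I_n.+1 |
      let l := [seq nat_of_ord i | i <- s] in
      [&& path.sorted geq l, all (ltn O) l & sumn l == n]]|.

(* [v] is the integral of [f] along the straight segment from [a] to [b], taken
   as an improper Riemann integral at both ends since [f] may be singular
   there. *)
Definition is_segment_integral (f : C -> C) (a b v : C) : Prop :=
  is_RInt_gen (V := C_R_NormedModule)
    (fun s : R => (f (a + RtoC s * (b - a)) * (b - a))%C)
    (at_right 0) (at_left 1) v.

(* Main.v *)
Require Import Defs.
From mathcomp Require Import all_boot.
From mathcomp Require Import zify.
From Stdlib Require Import Reals Lra Lia.
From Coquelicot Require Import Coquelicot.
Open Scope R_scope.

(* Put p = q^2 and x = i t. By the Jacobi triple product, theta_4(x, q) is the product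
   of (p; p), (q z; p) and (q / z; p) with z = e^(-2 t), where (y; p) is the infinite
   product of the factors 1 - y p^n. Euler's product gives (p; p) as the inverse of the
   partition series. On the segment q z and q / z become p^(1 - s) and p^s, 0 < s < 1.
   Since ln (y; p) = - sum_k y^k / (k (1 - p^k)), the function ln (p^s; p) of s has the
   primitive - A(p^s) / ln p with A(y) = sum_k y^k / (k^2 (1 - p^k)), which extends
   continuously to the end points, and A(1) - A(p) = zeta(2). *)

(** * Dominated convergence of series *)

(** Expanding ln (1 - y p^n) and summing over n first gives the series for ln (y; p). Here that
    series is the definition, and the product is recovered from a functional equation in y, so no
    double sum has to be exchanged. In the same way A(y) is the sum of Li_2(y p^n) over n >= 0,
    which is why A(1) - A(p) collapses to Li_2(1). Each of the two non-constant factors contributes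
    zeta(2) / (2 ln q) to the integral over s, and dx = i ln q ds turns their sum into i zeta(2);
    the constant factor (p; p) yields the partition term. The obstacle sits at the end points: one
    argument reaches 1, where ln (y; p) is singular, so the fundamental theorem applies only
    strictly inside and the limits of the primitive need A at the edge of its disk of convergence.
    This limit, the passage from bounded to arbitrary parts, and the passage from a finite to the
    infinite triple product are all limits of series under a summable bound; the first is along a
    real filter and the others along integers, hence the generality in the filter. *)

Lemma filterlim_sum_f_R0 {T : Type} (F : (T -> Prop) -> Prop) {FF : Filter F}
    (u : T -> nat -> R) (v : nat -> R) (n : nat) :
  (forall k, filterlim (fun t => u t k) F (locally (v k))) ->
  filterlim (fun t => sum_f_R0 (u t) n) F (locally (sum_f_R0 v n)).
Proof.
move=> Hu; elim: n => [|n IHn] /=; first exact: Hu.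
apply: filterlim_comp_2 IHn (Hu n.+1) _.
exact: (filterlim_plus (V := R_NormedModule) (sum_f_R0 v n) (v n.+1)).
Qed.

Lemma Series_abs_le (a b : nat -> R) :
  (forall n, Rabs (a n) <= b n) -> ex_series b -> Rabs (Series a) <= Series b.
Proof.
move=> Hab Hb.
have Ha : ex_series (fun n => Rabs (a n)).
  apply: (ex_series_le (V := R_CompleteNormedModule) _ b) => // n.
  by rewrite /norm /= /abs /= Rabs_Rabsolu.
apply: Rle_trans (Series_Rabs _ Ha) _.
by apply: Series_le => // n; split; [exact: Rabs_pos|].
Qed.

Lemma Series_tail_small (M : nat -> R) (eps : posreal) :
  ex_series M -> exists N, Rabs (Series (fun k => M (Nat.add (S N) k))) < eps.
Proof.
move=> HM.
have := Series_correct _ HM; move/is_series_Reals => /(_ eps (cond_pos eps)) [N HN].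
exists N; have := HN N (Nat.le_refl _); rewrite /R_dist.
rewrite (Series_incr_n M (S N)) //; last by lia.
by rewrite /= => H; rewrite -Rabs_Ropp; apply: Rle_lt_trans H; apply: Req_le; f_equal; ring.
Qed.

(* Tannery's theorem along an arbitrary filter. *)
Lemma filterlim_Series_dominated {T : Type} (F : (T -> Prop) -> Prop)
    {FF : ProperFilter F} (u : T -> nat -> R) (v M : nat -> R) :
  F (fun t => forall k, Rabs (u t k) <= M k) -> ex_series M ->
  (forall k, filterlim (fun t => u t k) F (locally (v k))) ->
  filterlim (fun t => Series (u t)) F (locally (Series v)).
Proof.
move=> Hdom HM Hlim.
have Hv k : Rabs (v k) <= M k.
  have Habs : filterlim (fun t => Rabs (u t k)) F (locally (Rabs (v k))).
    exact: filterlim_comp (Hlim k) (continuous_Rabs (v k)).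
  have Hc : filterlim (fun _ : T => M k) F (locally (M k)) by apply: filterlim_const.
  apply: (@filterlim_le T F _ _ _ (Finite (Rabs (v k))) (Finite (M k)) _ Habs Hc).
  by apply: filter_imp Hdom => t; apply.
have Hex w : (forall k, Rabs (w k) <= M k) -> ex_series w.
  by move=> Hw; apply: (ex_series_le (V := R_CompleteNormedModule) _ M).
have Hsplit w n : (forall k, Rabs (w k) <= M k) ->
    Rabs (Series w - sum_f_R0 w n) <= Series (fun k => M (Nat.add (S n) k)).
  move=> Hw; rewrite (Series_incr_n w (S n)); [|lia|exact: Hex].
  rewrite /= [X in Rabs X](_ : _ = Series (fun k => w (S (Nat.add n k)))); last by ring.
  apply: Series_abs_le => [k|]; first exact: Hw.
  exact: (proj1 (ex_series_incr_n (V := R_NormedModule) M (S n)) HM).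
apply/filterlim_locally => eps.
(* Budget: [eps / 4] for each of the two tails and [eps / 2] for the difference of the heads. *)
have [N HN] := Series_tail_small M (pos_div_2 (pos_div_2 eps)) HM.
have Hfin : F (fun t => ball (sum_f_R0 v N) (pos_div_2 eps) (sum_f_R0 (u t) N)).
  by apply: (proj1 (filterlim_locally (F := F) _ _)); exact: (filterlim_sum_f_R0 F).
apply: filter_imp (filter_and _ _ Hfin Hdom) => t [Ht Hd].
have := Hsplit _ N Hd; have := Hsplit _ N Hv.
move: Ht HN; rewrite /ball /= /AbsRing_ball /= /abs /minus /plus /opp /=.
move: (Series (fun k => M _)) (Series (u t)) (Series v) (sum_f_R0 _ _) (sum_f_R0 _ _) => m a b c d.
by split_Rabs; lra.
Qed.

Lemma is_lim_seq_Series_dominated (u : nat -> nat -> R) (v M : nat -> R) :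
  (forall n k, Rabs (u n k) <= M k) -> ex_series M ->
  (forall k, is_lim_seq (fun n => u n k) (v k)) ->
  is_lim_seq (fun n => Series (u n)) (Series v).
Proof.
move=> Hd HM Hl; apply: (filterlim_Series_dominated eventually u v M) => //.
by exists O.
Qed.

Lemma Series_finite (a : nat -> R) (N : nat) :
  (forall n, (N < n)%coq_nat -> a n = 0) -> Series a = sum_f_R0 a N.
Proof.
move=> Ha; apply: is_series_unique; apply/is_series_Reals => eps Heps.
exists N => n Hn; rewrite /R_dist.
have -> : sum_f_R0 a n = sum_f_R0 a N.
  elim: Hn => //= m Hm ->; rewrite Ha; first by ring.
  by lia.
by rewrite Rminus_diag Rabs_R0.
Qed.

Lemma CV_radius_ge_1 (a : nat -> R) (M : R) :
  (forall n, Rabs (a n) <= M) -> Rbar_le 1 (CV_radius a).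
Proof.
move=> Ha; case: (CV_radius_bounded a) => H _; apply: H; exists M => n.
by rewrite pow1 Rmult_1_r.
Qed.

(** Continuity inside the disk says nothing at 1 when the radius of convergence is 1; absolutely
    summable coefficients dominate the terms for every [y] with absolute value at most 1. *)
Lemma PSeries_left_continuous_1 (a : nat -> R) :
  ex_series (fun n => Rabs (a n)) ->
  filterlim (PSeries a) (at_left 1) (locally (PSeries a 1)).
Proof.
move=> Ha.
apply: (filterlim_Series_dominated (at_left 1) _ _ (fun n => Rabs (a n))) => // [|k].
  exists (mkposreal 1 Rlt_0_1) => y Hy Hy1 k.
  rewrite Rabs_mult -RPow_abs -[X in _ <= X]Rmult_1_r.
  apply: Rmult_le_compat_l; first exact: Rabs_pos.
  rewrite -(pow1 k); apply: pow_incr; split; first exact: Rabs_pos.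
  move: Hy; rewrite /ball /= /AbsRing_ball /= /abs /minus /plus /opp /=.
  by split_Rabs; lra.
apply: (filterlim_filter_le_1 (F := locally 1)); first exact: filter_le_within.
have H : continuous (fun x => a k * x ^ k) 1.
  apply: (ex_derive_continuous (V := R_NormedModule)).
  by auto_derive.
exact: H.
Qed.

(** * The logarithm of a q-Pochhammer product *)

Lemma ex_series_inv_sqr : ex_series (fun n => / (INR (S n) ^ 2)).
Proof.
have Hpos n : 0 < INR (S n) by apply: lt_0_INR; lia.
have [l Hl] : ex_finite_lim_seq (sum_f_R0 (fun n => / (INR (S n) ^ 2))).
  apply: (ex_finite_lim_seq_incr _ 2) => n.
    have : 0 < / (INR (S (S n)) ^ 2) by apply: Rinv_0_lt_compat; apply: pow_lt.
    by rewrite tech5; lra.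
  (* The strengthened bound makes the induction work, by 1/(x+1)^2 <= 1/x - 1/(x+1). *)
  suff : sum_f_R0 (fun n => / (INR (S n) ^ 2)) n <= 2 - / INR (S n).
    by have := Rinv_0_lt_compat _ (Hpos n); lra.
  elim: n => [|n IHn]; first by rewrite /=; lra.
  rewrite tech5; apply: Rle_trans (Rplus_le_compat_r _ _ _ IHn) _.
  have -> : INR (S (S n)) = INR (S n) + 1 by rewrite S_INR.
  move: (INR (S n)) (Hpos n) => x Hx.
  suff : / x - / (x + 1) - / ((x + 1) ^ 2) = / (x * (x + 1) ^ 2).
    have : 0 < / (x * (x + 1) ^ 2).
      by apply: Rinv_0_lt_compat; apply: Rmult_lt_0_compat => //; apply: pow_lt; lra.
    by lra.
  by field; lra.
exists l; apply/is_series_Reals/is_lim_seq_Reals; exact: Hl.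
Qed.

Lemma pow_lt_1 (p : R) (n : nat) : 0 < p < 1 -> 0 < p ^ S n <= p.
Proof.
move=> Hp; split; first by apply: pow_lt; lra.
rewrite /= -[X in _ <= X]Rmult_1_r; apply: Rmult_le_compat_l; first by lra.
by rewrite -(pow1 n); apply: pow_incr; lra.
Qed.

(* The value at 0 is the junk value [/ 0 = 0] in both definitions. *)
Definition qln_coef (p : R) (k : nat) : R := / (INR k * (1 - p ^ k)).

Definition qdilog_coef (p : R) (k : nat) : R := / (INR k ^ 2 * (1 - p ^ k)).

(* The logarithm of the infinite product of the 1 - y p^n, n >= 0. *)
Definition qln (p y : R) : R := - PSeries (qln_coef p) y.

Definition qdilog (p y : R) : R := PSeries (qdilog_coef p) y.

Fixpoint qpoch (p y : R) (N : nat) : R :=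
  if N is S n then qpoch p y n * (1 - y * p ^ n) else 1.

Section QLog.

Variable p : R.
Hypothesis Hp : 0 < p < 1.

Lemma qln_coef_0 : qln_coef p 0 = 0.
Proof. by rewrite /qln_coef /= Rmult_0_l Rinv_0. Qed.

Lemma qdilog_coef_0 : qdilog_coef p 0 = 0.
Proof. by rewrite /qdilog_coef /= !Rmult_0_l Rinv_0. Qed.

Lemma qdilog_coef_bound (k : nat) :
  Rabs (qdilog_coef p (S k)) <= / (1 - p) * / (INR (S k) ^ 2).
Proof.
have H1 : 0 < INR (S k) by apply: lt_0_INR; lia.
have H2 := pow_lt_1 p k Hp.
have H3 : 0 < INR (S k) ^ 2 by apply: pow_lt.
rewrite /qdilog_coef Rabs_pos_eq; last first.
  by apply: Rlt_le; apply: Rinv_0_lt_compat; apply: Rmult_lt_0_compat => //; lra.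
rewrite Rinv_mult Rmult_comm; apply: Rmult_le_compat_r.
  by apply: Rlt_le; apply: Rinv_0_lt_compat.
by apply: Rinv_le_contravar; lra.
Qed.

Lemma qln_coef_bound (k : nat) : Rabs (qln_coef p k) <= / (1 - p).
Proof.
have H0 : 0 < / (1 - p) by apply: Rinv_0_lt_compat; lra.
case: k => [|k]; first by rewrite qln_coef_0 Rabs_R0; lra.
have H1 : 1 <= INR (S k) by rewrite S_INR; have := pos_INR k; lra.
have H2 := pow_lt_1 p k Hp.
have H3 : 1 - p <= INR (S k) * (1 - p ^ S k) by nra.
rewrite /qln_coef Rabs_pos_eq; last first.
  by apply: Rlt_le; apply: Rinv_0_lt_compat; lra.
by apply: Rinv_le_contravar; lra.
Qed.

Lemma ex_series_qdilog_coef : ex_series (fun k => Rabs (qdilog_coef p k)).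
Proof.
apply/(ex_series_incr_1 (V := R_NormedModule)).
apply: (ex_series_le (V := R_CompleteNormedModule) _
  (fun k => / (1 - p) * / (INR (S k) ^ 2))) => [k|].
  by rewrite /norm /= /abs /= Rabs_Rabsolu; exact: qdilog_coef_bound.
exact: (ex_series_scal_l (V := R_NormedModule)) ex_series_inv_sqr.
Qed.

Lemma qln_CV_radius (y : R) : Rabs y < 1 -> Rbar_lt (Rabs y) (CV_radius (qln_coef p)).
Proof.
by move=> Hy; apply: Rbar_lt_le_trans (CV_radius_ge_1 _ _ qln_coef_bound).
Qed.

Lemma qdilog_CV_radius (y : R) :
  Rabs y < 1 -> Rbar_lt (Rabs y) (CV_radius (qdilog_coef p)).
Proof.
move=> Hy; apply: Rbar_lt_le_trans (CV_radius_ge_1 _ (/ (1 - p)) _) => // k.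
have H0 : 0 < / (1 - p) by apply: Rinv_0_lt_compat; lra.
case: k => [|k]; first by rewrite qdilog_coef_0 Rabs_R0; lra.
apply: Rle_trans (qdilog_coef_bound k) _.
rewrite -[X in _ <= X]Rmult_1_r; apply: Rmult_le_compat_l; first by lra.
rewrite -Rinv_1; apply: Rinv_le_contravar; first by lra.
have H1 : 1 <= INR (S k) by rewrite S_INR; have := pos_INR k; lra.
by rewrite -[X in X <= _](pow1 2); apply: pow_incr; lra.
Qed.

Lemma is_derive_qdilog (y : R) :
  Rabs y < 1 -> y <> 0 -> is_derive (qdilog p) y (- qln p y / y).
Proof.
move=> Hy Hy0; have := is_derive_PSeries _ _ (qdilog_CV_radius _ Hy).
have -> : PSeries (PS_derive (qdilog_coef p)) y = - qln p y / y; last by [].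
(* Multiplying by [y] realigns the powers, so the claim becomes k / k^2 = 1 / k on coefficients;
   index 0 relies on the default value of [qln_coef]. *)
rewrite /qln Ropp_involutive; apply: (Rmult_eq_reg_l y) => //.
rewrite -PSeries_incr_1 (PSeries_ext _ (qln_coef p)); first by field.
case=> [|k]; first by rewrite qln_coef_0.
rewrite /PS_incr_1 /PS_derive /qln_coef /qdilog_coef.
have H1 : 0 < INR (S k) by apply: lt_0_INR; lia.
have H2 := pow_lt_1 p k Hp.
by field; lra.
Qed.

Lemma continuous_qln (y : R) : Rabs y < 1 -> continuous (qln p) y.
Proof.
move=> Hy; apply: (continuous_opp (V := R_NormedModule)).
by apply/continuity_pt_filterlim; apply: PSeries_continuity; exact: qln_CV_radius.
Qed.

Lemma qln_0 : qln p 0 = 0.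
Proof. by rewrite /qln PSeries_0 qln_coef_0 Ropp_0. Qed.

Lemma qln_le_0 (y : R) : 0 <= y < 1 -> qln p y <= 0.
Proof.
move=> Hy.
have Hex : ex_series (fun k => qln_coef p k * y ^ k).
  apply: ex_series_Rabs; apply: CV_disk_inside; apply: qln_CV_radius.
  by rewrite Rabs_pos_eq; lra.
have Hpos k : 0 <= qln_coef p k * y ^ k.
  apply: Rmult_le_pos; last by apply: pow_le; lra.
  case: k => [|k]; first by rewrite qln_coef_0; lra.
  have H1 : 0 < INR (S k) by apply: lt_0_INR; lia.
  have H2 := pow_lt_1 p k Hp.
  by apply: Rlt_le; apply: Rinv_0_lt_compat; apply: Rmult_lt_0_compat => //; lra.
have := sum_incr _ O _ (proj1 (is_series_Reals _ _) (Series_correct _ Hex)) Hpos.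
by rewrite /qln /PSeries /=; have := Hpos O; rewrite /=; lra.
Qed.

Lemma is_derive_qln (y : R) :
  Rabs y < 1 -> is_derive (qln p) y (- PSeries (PS_derive (qln_coef p)) y).
Proof.
move=> Hy; apply: (is_derive_opp (V := R_NormedModule)).
by apply: is_derive_PSeries; exact: qln_CV_radius.
Qed.

(** The coefficients of the derivative are 1 / (1 - p^(k+1)); subtracting p^(k+1) times each leaves
    1, hence a geometric series. *)
Lemma qln_derive_step (y : R) : Rabs y < 1 ->
  PSeries (PS_derive (qln_coef p)) y - p * PSeries (PS_derive (qln_coef p)) (p * y)
    = / (1 - y).
Proof.
move=> Hy.
have Hex z : Rabs z < 1 -> ex_series (fun k => PS_derive (qln_coef p) k * z ^ k).
  move=> Hz; apply: ex_series_Rabs; apply: CV_disk_inside.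
  by rewrite CV_radius_derive; exact: qln_CV_radius.
have Hpy : Rabs (p * y) < 1.
  by rewrite Rabs_mult (Rabs_pos_eq p); [have := Rabs_pos y; nra|lra].
rewrite /PSeries -Series_scal_l -Series_minus; last 2 first.
- exact: Hex.
- exact: (ex_series_scal_l (V := R_NormedModule) p _ (Hex _ Hpy)).
rewrite -(Series_geom y Hy); apply: Series_ext => k.
rewrite /PS_derive /qln_coef Rpow_mult_distr.
have H1 : 0 < INR (S k) by apply: lt_0_INR; lia.
have H2 := pow_lt_1 p k Hp; move: H2; rewrite [p ^ S k]/= => H2.
by field; lra.
Qed.

(** Both sides vanish at 0 and have the same derivative by [qln_derive_step]. This is the logarithm
    of (y; p) = (1 - y)(p y; p), the link between the power series and the product. *)
Lemma qln_step (y : R) : 0 <= y < 1 -> qln p y = ln (1 - y) + qln p (p * y).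
Proof.
move=> Hy.
have [Hy0|->] : 0 < y \/ y = 0 by lra.
  have Hd t : 0 <= t <= y ->
      is_derive (fun t => qln p t - qln p (p * t) - ln (1 - t)) t zero.
    move=> Ht; have H1 : Rabs t < 1 by split_Rabs; lra.
    have H2 : Rabs (p * t) < 1 by rewrite Rabs_pos_eq; nra.
    have D1 := is_derive_qln _ H1; have D2 := is_derive_qln _ H2.
    have D3 : is_derive (fun t => ln (1 - t)) t (- / (1 - t)).
      by auto_derive; [lra|field; lra].
    have D4 : is_derive (fun t => p * t) t p by auto_derive => //; ring.
    have D5 := is_derive_comp _ _ _ _ _ D2 D4.
    have D6 := is_derive_minus _ _ _ _ _ (is_derive_minus _ _ _ _ _ D1 D5) D3.
    suff <- : minus (minus (- PSeries (PS_derive (qln_coef p)) t)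
       (scal p (- PSeries (PS_derive (qln_coef p)) (p * t)))) (- / (1 - t)) = zero by [].
    rewrite /minus /plus /opp /scal /= /mult /= -(qln_derive_step _ H1) /zero /=; ring.
  have := eq_is_derive _ _ _ Hd Hy0.
  by rewrite Rmult_0_r qln_0 (Rminus_0_r 1) ln_1; lra.
by rewrite Rmult_0_r Rminus_0_r ln_1; lra.
Qed.

(** Iterating [qln_step] telescopes. The remainder [qln p (y * p ^ N)] tends to [qln p 0 = 0], which
    identifies [qln] as the logarithm of the infinite product. *)
Lemma qpoch_qln (y : R) (N : nat) : 0 <= y < 1 ->
  qpoch p y N = exp (qln p y - qln p (y * p ^ N)).
Proof.
move=> Hy.
have Hn n : 0 <= y * p ^ n < 1.
  have H1 : 0 <= p ^ n <= 1.
    by split; [apply: pow_le; lra|rewrite -(pow1 n); apply: pow_incr; lra].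
  by nra.
have Hs n : qln p (y * p ^ n) = ln (1 - y * p ^ n) + qln p (y * p ^ S n).
  by rewrite (qln_step _ (Hn n)); congr (_ + qln p _); rewrite /=; ring.
have He n : 1 - y * p ^ n = exp (qln p (y * p ^ n) - qln p (y * p ^ S n)).
  rewrite Hs [X in exp X](_ : _ = ln (1 - y * p ^ n)); last by ring.
  by rewrite exp_ln //; have := Hn n; lra.
elim: N => [|N IHN]; first by rewrite /= Rmult_1_r Rminus_diag exp_0.
have -> : qpoch p y (S N) = qpoch p y N * (1 - y * p ^ N) by [].
by rewrite IHN He -exp_plus; congr exp; ring.
Qed.

Lemma is_lim_seq_qpoch (y : R) :
  0 <= y < 1 -> is_lim_seq (qpoch p y) (exp (qln p y)).
Proof.
move=> Hy.
apply: (is_lim_seq_ext (fun N => exp (qln p y - qln p (y * p ^ N)))).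
  by move=> N; rewrite qpoch_qln.
apply: is_lim_seq_continuous; first exact: derivable_continuous_pt (derivable_pt_exp _).
rewrite -[X in is_lim_seq _ (Finite X)]Rminus_0_r -[X in _ - X]qln_0.
apply: is_lim_seq_minus'; first exact: is_lim_seq_const.
apply: is_lim_seq_continuous.
  by apply/continuity_pt_filterlim; apply: continuous_qln; rewrite Rabs_R0; lra.
rewrite -(Rmult_0_r y); apply: is_lim_seq_mult'; first exact: is_lim_seq_const.
apply: is_lim_seq_geom.
by rewrite Rabs_pos_eq; lra.
Qed.

End QLog.

(** * Partitions *)

Definition is_part (k n : nat) (l : seq nat) : bool :=
  [&& path.sorted geq l, all (fun i => 0 < i <= k)%nat l & sumn l == n].

(* The partitions counted by [is_part k n] are split according to whether k
   occurs; [f] is fuel. *)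
Fixpoint parts (f k n : nat) : seq (seq nat) :=
  match f, k with
  | O, _ => [::]
  | S _, O => if n is O then [:: [::]] else [::]
  | S f, S j => parts f j n ++
      (if (j < n)%nat then [seq S j :: l | l <- parts f (S j) (n - S j)%nat] else [::])
  end.

(** Both recursive calls lower [k + n], so the fuel never runs out. A sorted list starts with its
    largest part: a head below [S j] belongs to the first half, a head equal to [S j] to the second,
    a larger head to neither. *)
Lemma mem_parts (f k n : nat) (l : seq nat) :
  (k + n < f)%nat -> (l \in parts f k n) = is_part k n l.
Proof.
elim: f k n l => [//|f IHf] [|j] n l Hf /=.
  case: n Hf => [|n] _; rewrite /is_part ?inE.
    by case: l => [//|[|a] l]; rewrite /= ?andbF.
  by case: l => [//|[|a] l]; rewrite /= ?andbF.
rewrite mem_cat IHf; last by lia.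
case: l => [|a l].
  rewrite [X in _ || X](_ : _ = false) ?orbF //.
  by case: ifP => // _; apply/negP => /mapP[].
have -> : ((a :: l) \in (if (j < n)%nat then [seq S j :: l | l <- parts f (S j) (n - S j)%nat]
    else [::])) = [&& (a == S j), (j < n)%nat & is_part (S j) (n - S j)%nat l].
  case: ifP => Hjn; last by rewrite !andbF.
  case: eqP => [->|Ha]; last by apply/negP => /mapP[l' _ [/Ha]].
  rewrite mem_map; last by move=> ? ? [].
  by rewrite IHf //; lia.
rewrite /is_part /= !(path_sortedE (rev_trans leq_trans)).
have Hmono m : all (fun i => 0 < i <= m)%nat l -> all (geq m) l.
  by apply: sub_all => i /andP[].
case: (ltngtP a (S j)) => Haj /=; rewrite ?orbF ?andbF //.
- rewrite -!andbA; have -> : (a <= j)%nat by lia.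
  case Hs : (all (geq a) l) => //=.
  have H m : (a <= m)%nat -> all (fun i => 0 < i <= m)%nat l = all (fun i => 0 < i)%nat l.
    move=> Ham; apply/idP/idP; first by apply: sub_all => i /andP[].
    move=> H0; apply/allP => i Hi; rewrite (allP H0) //=.
    by apply: leq_trans Ham; exact: (allP Hs).
  by rewrite !H //; lia.
- have -> : (a <= j)%nat = false by lia.
  by rewrite !andbF.
- rewrite Haj; have -> : (S j <= j)%nat = false by lia.
  change (path.sorted (fun x : nat => leq^~ x) l) with (path.sorted geq l).
  rewrite !andbF /=.
  case Hall : (all (fun i => 0 < i <= S j)%nat l); rewrite /= ?andbF //.
  have -> : all (leq^~ (S j)) l = true by exact: Hmono.
  case: (path.sorted geq l); rewrite /= ?andbF //.
  lia.
Qed.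

Lemma uniq_parts (f k n : nat) : (k + n < f)%nat -> uniq (parts f k n).
Proof.
elim: f k n => [//|f IHf] [|j] n Hf /=; first by case: n {Hf}.
have Hj : uniq (parts f j n) by apply: IHf; lia.
case: ifP => Hjn; last by rewrite cats0.
have Hk : uniq (parts f (S j) (n - S j)%nat) by apply: IHf; lia.
rewrite cat_uniq Hj map_inj_uniq ?Hk ?andbT /=; last by move=> ? ? [].
apply/hasPn => l /mapP[l' _ ->] /=; rewrite mem_parts; last by lia.
by rewrite /is_part /= ltnn !andbF.
Qed.

Definition npart (k n : nat) : nat := size (parts (S (k + n)) k n).

Lemma npart_fuel (f k n : nat) : (k + n < f)%nat -> size (parts f k n) = npart k n.
Proof.
move=> Hf; apply/perm_size/uniq_perm; try exact: uniq_parts.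
by move=> l; rewrite !mem_parts.
Qed.

Lemma npart_0 (n : nat) : npart 0 n = (n == 0%nat).
Proof. by case: n. Qed.

(** On generating functions this recursion is division by 1 - p^(k+1), one factor of Euler's
    product. *)
Lemma npartS (k n : nat) :
  npart (S k) n = (npart k n + if (k < n)%nat then npart (S k) (n - S k) else 0)%nat.
Proof.
have Hparts : parts (S (S k + n)) (S k) n = parts (S k + n) k n ++
    (if (k < n)%nat then [seq S k :: l | l <- parts (S k + n) (S k) (n - S k)%nat] else [::]).
  by [].
rewrite {1}/npart Hparts size_cat npart_fuel //; congr addn.
by case: ifP => // Hkn; rewrite size_map npart_fuel //; lia.
Qed.

Lemma npart_P (n : nat) : npart n n = P n.
Proof.
rewrite /P cardE /npart.
pose val_seq (s : n.-bseq 'I_n.+1) := [seq nat_of_ord i | i <- s].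
set A := finset _.
have Hinj : injective val_seq.
  by move=> s t /(inj_map val_inj) /val_inj.
rewrite -(size_map val_seq (enum A)); apply/perm_size/uniq_perm.
- by apply: uniq_parts.
- by rewrite map_inj_uniq // enum_uniq.
move=> l; rewrite mem_parts //; apply/idP/mapP => [|[s]].
  case/and3P=> Hs Ha /eqP Hn.
  (* Positive parts force the length below the sum, so a partition of [n] fits into the bounded
     sequences over which [P] counts. *)
  have Hsum (m : seq nat) : all (fun i => 0 < i <= n)%nat m -> (size m <= sumn m)%nat.
    by elim: m => //= a m IHm /andP[H1 /IHm]; lia.
  have Hsz : (size [seq inord i : 'I_n.+1 | i <- l] <= n)%nat.
    by rewrite size_map -[X in (_ <= X)%nat]Hn; exact: Hsum.
  have Hl : l = val_seq (Bseq Hsz).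
    rewrite /val_seq /= -map_comp -[LHS]map_id; apply/eq_in_map => i Hi /=.
    by rewrite inordK //; have /andP[] := allP Ha _ Hi.
  exists (Bseq Hsz) => //; rewrite mem_enum inE /= -/(val_seq (Bseq Hsz)) -Hl Hs Hn eqxx andbT.
  by apply: sub_all Ha => i /andP[].
rewrite mem_enum inE => /and3P[Hs Ha Hn] ->; apply/and3P; split => //.
apply/allP => i Hi; have /= -> := allP Ha _ Hi.
by case/mapP: Hi => j _ ->; rewrite /=; have := ltn_ord j; lia.
Qed.

Lemma npart_P_le (k n : nat) : (n <= k)%nat -> npart k n = P n.
Proof.
elim: k => [|k IHk] Hk; first by have -> : n = 0%nat by [lia]; exact: npart_P.
have [Hn|Hn] := leqP n k; last by have -> : n = S k by [lia]; exact: npart_P.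
by rewrite npartS ltnNge Hn /= addn0; exact: IHk.
Qed.

Lemma npart_le_P (k n : nat) : (npart k n <= P n)%nat.
Proof.
have Hmono m : (npart k n <= npart (m + k) n)%nat.
  elim: m => [//|m IHm]; apply: leq_trans IHm _.
  by rewrite addSn npartS leq_addr.
by rewrite -(npart_P_le (n + k) n) ?leq_addr //; exact: Hmono.
Qed.

Definition shift_seq (m : nat) (b : nat -> R) (n : nat) : R :=
  if (m <= n)%nat then b (n - m)%nat else 0.

Lemma is_series_shift (m : nat) (b : nat -> R) (l : R) :
  is_series b l -> is_series (shift_seq m b) l.
Proof.
case: m => [|m] Hb.
  by apply: is_series_ext Hb => n; rewrite /shift_seq subn0.
apply: (is_series_decr_n (V := R_NormedModule) _ (S m)); first by lia.
have -> : sum_n (shift_seq (S m) b) (Nat.pred (S m)) = 0.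
  rewrite (sum_n_ext_loc _ (fun _ => 0)); first by rewrite sum_n_const; exact: Rmult_0_r.
  by move=> n Hn; rewrite /shift_seq ifF //; lia.
rewrite /plus /opp /= Ropp_0 Rplus_0_r; apply: is_series_ext Hb => n.
by rewrite /shift_seq ifT; [congr b|]; lia.
Qed.

Lemma sum_f_R0_shift_le (m : nat) (b : nat -> R) (N : nat) :
  (forall n, 0 <= b n) -> sum_f_R0 (shift_seq m b) N <= sum_f_R0 b N.
Proof.
move=> Hb.
have Hmono j k : sum_f_R0 b j <= sum_f_R0 b (k + j).
  elim: k => [|k IHk]; first by rewrite add0n; lra.
  by rewrite addSn tech5; have := Hb (S (k + j)); lra.
have Hpos j : 0 <= sum_f_R0 b j.
  by elim: j => [|j IHj]; [exact: Hb | rewrite tech5; have := Hb (S j); lra].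
have -> : sum_f_R0 (shift_seq m b) N = if (m <= N)%nat then sum_f_R0 b (N - m) else 0.
  elim: N => [|N IHN]; first by case: m.
  rewrite tech5 IHN /shift_seq.
  case: (ltngtP m (S N)) => Hm.
  - rewrite ifT; last by lia.
    by have -> : (S N - m)%nat = S (N - m) by [lia]; rewrite tech5.
  - by rewrite ifF; [ring|lia].
  - by rewrite ifF; [rewrite Hm subnn /=; ring|lia].
case: ifP => Hm; last exact: Hpos.
by rewrite -{2}(subnKC Hm); exact: Hmono.
Qed.

Section PartitionSeries.

Variable p : R.
Hypothesis Hp : 0 < p < 1.

Let npart_term_ge0 (k n : nat) : 0 <= INR (npart k n) * p ^ n.
Proof. by apply: Rmult_le_pos; [exact: pos_INR|apply: pow_le; lra]. Qed.

(** The quotient (p^(k+1); p) / (p; p) is the product of the 1 / (1 - p^j) for 1 <= j <= k. *)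
Lemma is_series_npart (k : nat) :
  is_series (fun n => INR (npart k n) * p ^ n) (exp (qln p (p ^ S k) - qln p p)).
Proof.
elim: k => [|k IHk].
  rewrite /= Rmult_1_r Rminus_diag exp_0.
  have Hz n : (0 < n)%coq_nat -> INR (npart 0 n) * p ^ n = 0.
    by case: n => [|n] Hn; [lia|rewrite npart_0 /=; ring].
  apply/is_series_Reals => eps Heps; exists O => n _.
  have -> : sum_f_R0 (fun n => INR (npart 0 n) * p ^ n) n = 1.
    elim: n => [|n IHn]; first by rewrite /sum_f_R0 npart_0 /=; ring.
    by rewrite tech5 IHn Hz; [ring|lia].
  by rewrite /R_dist Rminus_diag Rabs_R0.
have Hr := pow_lt_1 p k Hp; set r := p ^ S k in Hr IHk *.
set a := fun n => INR (npart k n) * p ^ n in IHk.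
set b := fun n => INR (npart (S k) n) * p ^ n.
have Hb0 n : 0 <= b n by exact: npart_term_ge0.
have Hab n : b n = a n + r * shift_seq (S k) b n.
  rewrite /b /a /shift_seq npartS; case: ifP => Hkn; last by rewrite addn0; ring.
  rewrite plus_INR Rmult_plus_distr_r /r -Rmult_assoc [_ * INR _]Rmult_comm Rmult_assoc -pow_add.
  by congr (_ + _ * p ^ _); lia.
(* Convergence is not yet known. As the terms are nonnegative, shifting only lowers a partial sum B,
   so B <= [Series a] + r B. *)
have Hbound N : sum_f_R0 b N <= Series a / (1 - r).
  have H1 : sum_f_R0 a N <= Series a.
    apply: sum_incr => [|n]; last exact: npart_term_ge0.
    by apply/is_series_Reals; rewrite (is_series_unique _ _ IHk).
  have H2 : sum_f_R0 b N = sum_f_R0 a N + r * sum_f_R0 (shift_seq (S k) b) N.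
    by rewrite scal_sum -plus_sum; apply: sum_eq => n _; rewrite Hab; ring.
  have H3 := sum_f_R0_shift_le (S k) b N Hb0.
  apply: (Rmult_le_reg_r (1 - r)); first by lra.
  by rewrite /Rdiv Rmult_assoc Rinv_l; nra.
have [l Hl] : ex_finite_lim_seq (sum_f_R0 b).
  apply: (ex_finite_lim_seq_incr _ (Series a / (1 - r))) => // n.
  by rewrite tech5; have := Hb0 (S n); lra.
have Hbl : is_series b l by apply/is_series_Reals/is_lim_seq_Reals.
(* Summing [Hab] gives a linear equation for the sum [l]; dividing by 1 - r is one application of
   [qln_step]. *)
have : is_series b (exp (qln p r - qln p p) + r * l).
  apply: (is_series_ext (fun n => plus (a n) (scal r (shift_seq (S k) b n)))).
    by move=> n; rewrite (Hab n).
  apply: (is_series_plus (V := R_NormedModule)) => //.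
  by apply: (is_series_scal_l (V := R_NormedModule)); exact: is_series_shift.
move/is_series_unique; rewrite (is_series_unique _ _ Hbl) => Hleq.
have -> : exp (qln p (p ^ S (S k)) - qln p p) = l; last by [].
apply: (Rmult_eq_reg_l (1 - r)); last by lra.
rewrite -[X in X * exp _]exp_ln; last by lra.
rewrite -exp_plus.
have -> : ln (1 - r) + (qln p (p ^ S (S k)) - qln p p) = qln p r - qln p p.
  have -> : p ^ S (S k) = p * r by [].
  by rewrite (qln_step p Hp r); [ring|lra].
lra.
Qed.

Lemma ln_Series_P : ln (Series (fun n => INR (P n) * p ^ n)) = - qln p p.
Proof.
have HP0 n : 0 <= INR (P n) * p ^ n.
  by apply: Rmult_le_pos; [exact: pos_INR|apply: pow_le; lra].
have HpS : is_lim_seq (fun k => p ^ S k) 0.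
  by apply/(is_lim_seq_incr_1 (fun n => p ^ n)); apply: is_lim_seq_geom; rewrite Rabs_pos_eq; lra.
have Hlim : is_lim_seq (fun k => exp (qln p (p ^ S k) - qln p p)) (exp (- qln p p)).
  apply: is_lim_seq_continuous; first exact: derivable_continuous_pt (derivable_pt_exp _).
  rewrite -[X in Finite X]Rplus_0_l -{1}(qln_0 p).
  apply: is_lim_seq_minus'; last exact: is_lim_seq_const.
  apply: is_lim_seq_continuous => //.
  by apply/continuity_pt_filterlim; apply: (continuous_qln p Hp); rewrite Rabs_R0; lra.
(* Up to index [N] the coefficients [P n] and [npart N n] agree, so the partial sum is at most the
   full series for parts up to [N], and [qln_le_0] bounds that independently of [N]. *)
have Hex : ex_series (fun n => INR (P n) * p ^ n).
  have [l Hl] : ex_finite_lim_seq (sum_f_R0 (fun n => INR (P n) * p ^ n)).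
    apply: (ex_finite_lim_seq_incr _ (exp (- qln p p))) => N.
      by rewrite tech5; have := HP0 (S N); lra.
    rewrite (sum_eq _ (fun n => INR (npart N n) * p ^ n)); last first.
      by move=> n Hn; rewrite npart_P_le //; lia.
    apply: Rle_trans (sum_incr _ _ _ _ (npart_term_ge0 N)) _.
      by apply/is_series_Reals; exact: is_series_npart.
    have Hq := qln_le_0 p Hp (p ^ S N); have HpN := pow_lt_1 p N Hp.
    have [Hlt|->] : qln p (p ^ S N) - qln p p < - qln p p \/
      qln p (p ^ S N) - qln p p = - qln p p by lra.
      by apply: Rlt_le; exact: exp_increasing.
    lra.
  by exists l; apply/is_series_Reals/is_lim_seq_Reals.
rewrite -[RHS]ln_exp; congr ln.
have HT : is_lim_seq (fun k => Series (fun n => INR (npart k n) * p ^ n))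
    (Series (fun n => INR (P n) * p ^ n)).
  apply: (is_lim_seq_Series_dominated _ _ (fun n => INR (P n) * p ^ n)) => // [k n|n].
    rewrite Rabs_pos_eq; last exact: npart_term_ge0.
    apply: Rmult_le_compat_r; first by apply: pow_le; lra.
    by apply: le_INR; have := npart_le_P k n; lia.
  apply: (is_lim_seq_ext_loc (fun _ => INR (P n) * p ^ n)); last exact: is_lim_seq_const.
  by exists n => k Hk; rewrite npart_P_le //; lia.
have := is_lim_seq_unique _ _ HT.
rewrite (Lim_seq_ext _ (fun k => exp (qln p (p ^ S k) - qln p p))).
  by rewrite (is_lim_seq_unique _ _ Hlim) => -[].
by move=> k; apply: is_series_unique; exact: is_series_npart.
Qed.

End PartitionSeries.

(** * The Jacobi triple product *)

(** The Gaussian binomial coefficient in base p. Its vanishing for j > M lets finite sums be read as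
    infinite series. *)
Definition qbin (p : R) (M j : nat) : R :=
  if (j <= M)%nat then qpoch p p M / (qpoch p p j * qpoch p p (M - j)) else 0.

Lemma qpoch_add (p y : R) (N M : nat) :
  qpoch p y (N + M) = qpoch p y N * qpoch p (y * p ^ N) M.
Proof.
elim: M => [|M IHM]; first by rewrite addn0 /= Rmult_1_r.
by rewrite addnS /= IHM pow_add; ring.
Qed.

Lemma sum_f_R0_rev (f : nat -> R) (N : nat) :
  sum_f_R0 (fun n => f (N - n)%nat) N = sum_f_R0 f N.
Proof.
elim: N => [//|N IHN]; rewrite decomp_sum; last by lia.
rewrite [X in _ = X]tech5 -IHN Rplus_comm; congr (_ + _).
Qed.

(** The middle term lies in both halves; its correction becomes the [- 1] of
    [jacobi_triple_product]. *)
Lemma sum_f_R0_center (f : nat -> R) (N : nat) :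
  sum_f_R0 f (2 * N) =
    sum_f_R0 (fun n => f (N + n)%nat) N + sum_f_R0 (fun n => f (N - n)%nat) N - f N.
Proof.
rewrite sum_f_R0_rev; case: N => [|N]; first by rewrite muln0 /sum_f_R0 addn0; ring.
rewrite (tech2 f N); last by lia.
have -> : (2 * S N - S N)%coq_nat = S N by lia.
rewrite (tech5 f N) /Rminus Rplus_assoc (Rplus_assoc (sum_f_R0 f N)).
by rewrite Rplus_opp_r Rplus_0_r Rplus_comm.
Qed.

Section JacobiTripleProduct.

Variable q : R.
Hypothesis Hq : 0 < q < 1.

Local Notation p := (q ^ 2).

Let Hp : 0 < p < 1.
Proof. by split; [apply: pow_lt; lra|rewrite /=; nra]. Qed.

(** The finite products decrease to (p; p) > 0. A lower bound uniform in [n] is what bounds [qbin]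
    uniformly, as dominated convergence requires. *)
Lemma qpoch_pp_bounds (n : nat) : exp (qln p p) <= qpoch p p n <= 1.
Proof.
have Hn : 0 < p * p ^ n < 1 by have := pow_lt_1 p n Hp; rewrite -[p ^ S n]/(p * p ^ n); lra.
split.
  rewrite (qpoch_qln p Hp) //; last by lra.
  have H0 := qln_le_0 p Hp (p * p ^ n).
  have [Hlt|Heq] : qln p p < qln p p - qln p (p * p ^ n) \/
    qln p p = qln p p - qln p (p * p ^ n) by lra.
    by apply: Rlt_le; exact: exp_increasing.
  by rewrite -Heq; lra.
elim: n {Hn} => [|n IHn]; first by rewrite /=; lra.
have := pow_lt_1 p n Hp; rewrite -[p ^ S n]/(p * p ^ n).
rewrite -[qpoch p p (S n)]/(qpoch p p n * (1 - p * p ^ n)).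
move: (p * p ^ n) => r Hr.
suff : 0 <= qpoch p p n by nra.
rewrite (qpoch_qln p Hp); last by lra.
by apply: Rlt_le; exact: exp_pos.
Qed.

Lemma qpoch_pp_gt0 (n : nat) : 0 < qpoch p p n.
Proof. by have := qpoch_pp_bounds n; have := exp_pos (qln p p); lra. Qed.

Lemma qbin_sym (M j : nat) : (j <= M)%nat -> qbin p M (M - j) = qbin p M j.
Proof.
by move=> Hj; rewrite /qbin Hj leq_subr subKn // [qpoch p p j * _]Rmult_comm.
Qed.

(** The power of q is p^(j(j-1)/2); writing it in q avoids the halved exponent. *)
Definition qbinomial_coef (M j : nat) : R := (-1) ^ j * q ^ (j * j.-1) * qbin p M j.

Lemma qbinomial_coef_0 (M : nat) : qbinomial_coef M 0 = 1.
Proof.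
rewrite /qbinomial_coef /qbin leq0n subn0 /=; field.
by apply: Rgt_not_eq; exact: qpoch_pp_gt0.
Qed.

(** A form of the q-Pascal rule: it compares coefficients when [qpoch p x M] is multiplied by its
    next factor 1 - x p^M. *)
Lemma qbinomial_coef_step (M j : nat) :
  qbinomial_coef (S M) (S j) = qbinomial_coef M (S j) - p ^ M * qbinomial_coef M j.
Proof.
have Hpow i : q ^ (S i * i) = q ^ (i * i.-1) * p ^ i.
  by rewrite -pow_mult -pow_add; congr (_ ^ _); case: i => [|i]; nia.
have Hnz i := Rgt_not_eq _ _ (qpoch_pp_gt0 i).
have HS i : qpoch p p (S i) = qpoch p p i * (1 - p * p ^ i) by [].
have Hnz1 i : 1 - p * p ^ i <> 0.
  by move=> Heq; apply: (Hnz (S i)); rewrite HS Heq; ring.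
rewrite /qbinomial_coef /qbin; case: (ltngtP j M) => Hj.
- have [r ->] : exists r, M = (S (j + r))%nat by exists (M - S j)%nat; lia.
  rewrite !ifT; try by lia.
  have -> : (S (S (j + r)) - S j)%nat = S r by lia.
  have -> : (S (j + r) - S j)%nat = r by lia.
  have -> : (S (j + r) - j)%nat = S r by lia.
  rewrite (HS (S (j + r))%nat) !(HS j) !(HS r) -[(S j).-1]/j Hpow.
  rewrite -[p ^ S (j + r)]/(p * p ^ (j + r)) -[(-1) ^ S j]/(-1 * (-1) ^ j).
  have := Hnz1 j; have := Hnz1 r.
  rewrite pow_add => H1 H2.
  by field; repeat split; auto.
- rewrite !ifF; try by lia.
  by ring.
- rewrite Hj ?leqnn !subnn ?ifT; try by lia.
  rewrite -[(S M).-1]/M Hpow -[(-1) ^ S M]/(-1 * (-1) ^ M).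
  by rewrite -[qpoch p p 0]/1; field; repeat split; auto.
Qed.

Lemma qbinomial_theorem (x : R) (M : nat) :
  qpoch p x M = sum_f_R0 (fun j => qbinomial_coef M j * x ^ j) M.
Proof.
elim: M => [|M IHM]; first by rewrite /sum_f_R0 qbinomial_coef_0 /=; ring.
have Htop : qbinomial_coef M (S M) = 0 by rewrite /qbinomial_coef /qbin ltnn; ring.
have H1 : sum_f_R0 (fun j => qbinomial_coef M j * x ^ j) M
    = 1 + sum_f_R0 (fun j => qbinomial_coef M (S j) * x ^ S j) M.
  have := tech5 (fun j => qbinomial_coef M j * x ^ j) M; rewrite Htop Rmult_0_l Rplus_0_r => <-.
  by rewrite decomp_sum; [rewrite qbinomial_coef_0 pow_O Rmult_1_r|lia].
rewrite decomp_sum; last by lia.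
rewrite qbinomial_coef_0 pow_O Rmult_1_r -[Nat.pred (S M)]/M.
rewrite (sum_eq _ (fun j => qbinomial_coef M (S j) * x ^ S j
    + (qbinomial_coef M j * x ^ j) * (- (x * p ^ M)))); last first.
  by move=> j _; rewrite qbinomial_coef_step -[x ^ S j]/(x * x ^ j); ring.
rewrite plus_sum -scal_sum -IHM -Rplus_assoc -H1 -IHM.
have -> : qpoch p x (S M) = qpoch p x M * (1 - x * p ^ M) by [].
ring.
Qed.

(** At w = q z this is (-1)^n q^(n^2) z^n. Keeping one factor q^n inside w^n leaves the summable
    bound w^n as soon as w < 1. *)
Definition theta_term (w : R) (n : nat) : R := (-1) ^ n * q ^ (n * n.-1) * w ^ n.

(** Apply 1 - u = -u (1 - 1/u) to each factor and reverse the order: the values 1/u become (q / z)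
    p^m for m < N, and the prefactors -z / q^(2m+1) multiply to (-z)^N / q^(N^2), a sum of odd
    numbers. *)
Lemma qpoch_reflect (z : R) (N : nat) : z <> 0 ->
  qpoch p (z * q / p ^ N) N = qpoch p (q / z) N * ((- z) ^ N / q ^ (N * N)).
Proof.
move=> Hz; have Hq0 : q <> 0 by lra.
have Hpn n : p ^ n <> 0 by apply: pow_nonzero; lra.
elim: N => [|N IHN]; first by rewrite /=; field.
have -> : qpoch p (z * q / p ^ S N) (S N)
    = (1 - z * q / p ^ S N) * qpoch p (z * q / p ^ N) N.
  rewrite -{2}[S N]add1n qpoch_add; congr (_ * qpoch _ _ _).
    by rewrite /=; ring.
  by rewrite -[p ^ S N]/(p * p ^ N) pow_1; field; split.
rewrite IHN.
have -> : qpoch p (q / z) (S N) = qpoch p (q / z) N * (1 - q / z * p ^ N) by [].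
have -> : q ^ (S N * S N) = q ^ (N * N) * (p ^ N * q).
  by rewrite -pow_mult -{4}(pow_1 q) -!pow_add; congr (_ ^ _); nia.
rewrite -[p ^ S N]/(p * p ^ N) -[(- z) ^ S N]/(- z * (- z) ^ N).
by field; repeat split => //; apply: pow_nonzero.
Qed.

(* The q-binomial theorem with 2 N factors at x = z q^(1 - 2 N), recentred at the
   middle index N. *)
Lemma finite_jacobi_triple_product (z : R) (N : nat) : z <> 0 ->
  qpoch p (q * z) N * qpoch p (q / z) N =
    sum_f_R0 (fun n => theta_term (q * z) n * qbin p (2 * N) (N + n)) N
    + sum_f_R0 (fun n => theta_term (q / z) n * qbin p (2 * N) (N + n)) N
    - qbin p (2 * N) N.
Proof.
move=> Hz; have Hq0 : q <> 0 by lra.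
have Hpn n : p ^ n <> 0 by apply: pow_nonzero; lra.
have Hqn n : q ^ n <> 0 by apply: pow_nonzero.
have Hzn n : (- z) ^ n <> 0 by apply: pow_nonzero; lra.
have := qbinomial_theorem (z * q / p ^ N) (2 * N).
(* The first N factors are reflected into those with q / z; the last N are already those with q
   z. *)
have -> : qpoch p (z * q / p ^ N) (2 * N)
    = qpoch p (q * z) N * qpoch p (q / z) N * ((- z) ^ N / q ^ (N * N)).
  rewrite mul2n -addnn qpoch_add qpoch_reflect //.
  have -> : z * q / p ^ N * p ^ N = q * z by field.
  ring.
set c := (- z) ^ N / q ^ (N * N).
have Hc : c <> 0 by apply: Rmult_integral_contrapositive; split => //; exact: Rinv_neq_0_compat.
rewrite sum_f_R0_center => H; apply: (Rmult_eq_reg_r c) => //; rewrite {}H.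
have Hgen j : qbinomial_coef (2 * N) j * (z * q / p ^ N) ^ j
    = qbin p (2 * N) j * (- z) ^ j * (q ^ (j * j) / p ^ (N * j)).
  rewrite /qbinomial_coef /Rdiv (Rpow_mult_distr (z * q)) (Rpow_mult_distr z) pow_inv.
  have -> : (p ^ N) ^ j = p ^ (N * j)%nat by exact: esym (pow_mult p N j).
  have -> : q ^ (j * j) = q ^ (j * j.-1) * q ^ j.
    by rewrite -pow_add; congr (_ ^ _); case: j => [|j]; nia.
  have -> : (- z) ^ j = (-1) ^ j * z ^ j.
    by rewrite -Rpow_mult_distr; congr (_ ^ _); ring.
  ring.
(* Completing the square, j^2 - 2 N j = (j - N)^2 - N^2, stated without subtraction because the
   exponents are natural numbers. *)
have Hexp a b d e : (a + b = d + 2 * e)%nat -> q ^ a / p ^ e = q ^ d / q ^ b.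
  move=> Habd; have : q ^ a * q ^ b = q ^ d * p ^ e by rewrite -pow_mult -!pow_add; congr (_ ^ _).
  move=> Heq; apply: (Rmult_eq_reg_r (q ^ b * p ^ e)).
    by transitivity (q ^ a * q ^ b); [field|rewrite Heq; field]; repeat split; auto.
  by apply: Rmult_integral_contrapositive; split.
have Hterm w n : theta_term (q * w) n = (- w) ^ n * q ^ (n * n).
  rewrite /theta_term Rpow_mult_distr.
  have -> : q ^ (n * n) = q ^ (n * n.-1) * q ^ n.
    by rewrite -pow_add; congr (_ ^ _); case: n => [|n]; nia.
  have -> : (- w) ^ n = (-1) ^ n * w ^ n.
    by rewrite -Rpow_mult_distr; congr (_ ^ _); ring.
  ring.
rewrite Rmult_minus_distr_r Rmult_plus_distr_r; congr (_ + _ - _).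
- rewrite [RHS]Rmult_comm scal_sum; apply: sum_eq => n _.
  rewrite Hgen (Hexp _ (N * N)%nat (n * n)%nat); last by nia.
  by rewrite Hterm /c pow_add; field.
- rewrite [RHS]Rmult_comm scal_sum; apply: sum_eq => n Hn.
  have [r HN] : exists r, N = (r + n)%nat by exists (N - n)%nat; lia.
  have -> : (N - n)%nat = r by lia.
  rewrite Hgen (Hexp _ (N * N)%nat (n * n)%nat); last by rewrite HN; nia.
  have -> : qbin p (2 * N) r = qbin p (2 * N) (N + n).
    by rewrite -(qbin_sym (2 * N) r); [congr qbin|]; lia.
  rewrite Hterm /c.
  have -> : (- z) ^ N = (- z) ^ r * (- z) ^ n by rewrite HN pow_add.
  have -> : (- / z) ^ n = / (- z) ^ n by rewrite -pow_inv; congr (_ ^ _); field.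
  by field; split.
- rewrite Hgen (Hexp _ (N * N)%nat 0%nat); last by nia.
  by rewrite /c pow_O /Rdiv; ring.
Qed.

Lemma qbin_bounds (M j : nat) : 0 <= qbin p M j <= exp (- (2 * qln p p)).
Proof.
have He := exp_pos (qln p p).
have H2 := exp_pos (- (2 * qln p p)).
rewrite /qbin; case: ifP => _; last by lra.
have [Hj1 Hj2] := qpoch_pp_bounds j; have [Hr1 Hr2] := qpoch_pp_bounds (M - j).
have [HM1 HM2] := qpoch_pp_bounds M.
have Hd : exp (2 * qln p p) <= qpoch p p j * qpoch p p (M - j).
  have -> : 2 * qln p p = qln p p + qln p p by ring.
  by rewrite exp_plus; apply: Rmult_le_compat; lra.
have Hpos := exp_pos (2 * qln p p).
rewrite exp_Ropp; split.
  by apply: Rmult_le_pos; [lra|apply: Rlt_le; apply: Rinv_0_lt_compat; lra].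
rewrite -[X in _ <= X]Rmult_1_l; apply: Rmult_le_compat; try lra.
  by apply: Rlt_le; apply: Rinv_0_lt_compat; lra.
by apply: Rinv_le_contravar.
Qed.

Lemma is_lim_seq_qbin_center (n : nat) :
  is_lim_seq (fun N => qbin p (2 * N) (N + n)) (exp (- qln p p)).
Proof.
have He := exp_pos (qln p p).
have Hq1 : is_lim_seq (qpoch p p) (exp (qln p p)) by apply: is_lim_seq_qpoch => //; lra.
(* With N = m + n the lower index N - n is m, free of truncation. All three products then tend to
   (p; p), so the quotient tends to 1 / (p; p). *)
apply/(is_lim_seq_incr_n _ n).
apply: (is_lim_seq_ext
  (fun m => qpoch p p (2 * m + 2 * n)%coq_nat / (qpoch p p (m + 2 * n)%coq_nat * qpoch p p m))).
  move=> m; rewrite /qbin ifT; last by lia.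
  by congr (qpoch _ _ _ / (qpoch _ _ _ * qpoch _ _ _)); lia.
have -> : exp (- qln p p) = exp (qln p p) / (exp (qln p p) * exp (qln p p)).
  by rewrite exp_Ropp; field; lra.
apply: is_lim_seq_div'; last by apply: Rgt_not_eq; apply: Rmult_lt_0_compat.
- apply: (is_lim_seq_subseq (qpoch p p) _ (fun m => (2 * m + 2 * n)%coq_nat)) => //.
  by apply: eventually_subseq => m; lia.
- apply: is_lim_seq_mult' => //.
  exact: (proj1 (is_lim_seq_incr_n (qpoch p p) (2 * n) _)).
Qed.

Lemma theta_term_bound (w : R) (n : nat) : 0 <= w -> Rabs (theta_term w n) <= w ^ n.
Proof.
move=> Hw; rewrite /theta_term !Rabs_mult pow_1_abs Rmult_1_l.
have Hwn : 0 <= w ^ n by exact: pow_le.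
rewrite (Rabs_pos_eq (w ^ n)) // -[X in _ <= X]Rmult_1_l.
apply: Rmult_le_compat_r => //.
rewrite Rabs_pos_eq; last by apply: pow_le; lra.
by rewrite -(pow1 (n * n.-1)); apply: pow_incr; lra.
Qed.

Lemma ex_series_theta_term (w : R) : 0 <= w < 1 -> ex_series (theta_term w).
Proof.
move=> Hw; apply: (ex_series_le (V := R_CompleteNormedModule) _ (fun n => w ^ n)).
  by move=> n; apply: theta_term_bound; lra.
by apply: ex_series_geom; rewrite Rabs_pos_eq; lra.
Qed.

Lemma is_lim_seq_theta_partial (w : R) : 0 <= w < 1 ->
  is_lim_seq (fun N => sum_f_R0 (fun n => theta_term w n * qbin p (2 * N) (N + n)) N)
    (Series (theta_term w) * exp (- qln p p)).
Proof.
move=> Hw; rewrite Rmult_comm -Series_scal_l.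
(* [qbin] vanishes beyond n = N, so the finite sum is a series with a fixed index range, to which
   dominated convergence applies. *)
apply: (is_lim_seq_ext (fun N => Series (fun n => theta_term w n * qbin p (2 * N) (N + n)))).
  move=> N; apply: Series_finite => n Hn.
  by rewrite /qbin ifF; [ring|lia].
apply: (is_lim_seq_Series_dominated _ _ (fun n => exp (- (2 * qln p p)) * w ^ n)).
- move=> N n; rewrite Rabs_mult Rmult_comm.
  have Hb := qbin_bounds (2 * N) (N + n).
  rewrite (Rabs_pos_eq (qbin _ _ _)); last by lra.
  apply: Rmult_le_compat; [lra|exact: Rabs_pos|lra|].
  by apply: theta_term_bound; lra.
- apply: (ex_series_scal_l (V := R_NormedModule)).
  by apply: ex_series_geom; rewrite Rabs_pos_eq; lra.
- move=> n; rewrite Rmult_comm; apply: is_lim_seq_mult'; first exact: is_lim_seq_const.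
  exact: is_lim_seq_qbin_center.
Qed.

Theorem jacobi_triple_product (z : R) : 0 < z -> q * z < 1 -> q / z < 1 ->
  Series (theta_term (q * z)) + Series (theta_term (q / z)) - 1
    = exp (qln p p + qln p (q * z) + qln p (q / z)).
Proof.
move=> Hz H1 H2.
have H1' : 0 <= q * z by nra.
have H2' : 0 <= q / z by apply: Rmult_le_pos; [lra|apply: Rlt_le; exact: Rinv_0_lt_compat].
have L1 := is_lim_seq_mult' _ _ _ _ (is_lim_seq_qpoch p Hp _ (conj H1' H1))
  (is_lim_seq_qpoch p Hp _ (conj H2' H2)).
have L2 := is_lim_seq_minus' _ _ _ _ (is_lim_seq_plus' _ _ _ _
  (is_lim_seq_theta_partial _ (conj H1' H1)) (is_lim_seq_theta_partial _ (conj H2' H2)))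
  (is_lim_seq_qbin_center 0).
have L3 := is_lim_seq_unique _ _ (is_lim_seq_ext _
  (fun N => qpoch p (q * z) N * qpoch p (q / z) N) _ _ L2).
have Heq : exp (qln p (q * z)) * exp (qln p (q / z))
    = (Series (theta_term (q * z)) * exp (- qln p p) +
      Series (theta_term (q / z)) * exp (- qln p p) - exp (- qln p p)).
  apply/Rbar_finite_eq; rewrite -(is_lim_seq_unique _ _ L1) -L3 // => N.
  by rewrite addn0 finite_jacobi_triple_product //; lra.
rewrite -exp_plus in Heq.
have -> : qln p p + qln p (q * z) + qln p (q / z)
  = (qln p (q * z) + qln p (q / z)) + qln p p by ring.
rewrite exp_plus Heq exp_Ropp; field.
by apply: Rgt_not_eq; exact: exp_pos.
Qed.

End JacobiTripleProduct.

(** * The integral of log theta *)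

Lemma zeta_2 : zeta (RtoC 2) = RtoC (Series (fun n => / (INR (S n) ^ 2))).
Proof.
have Hterm n : Cexp (- RtoC 2 * RtoC (ln (INR (S n))))%C = RtoC (/ (INR (S n) ^ 2)).
  have Hn : 0 < INR (S n) by apply: lt_0_INR; lia.
  have -> : (- RtoC 2 * RtoC (ln (INR (S n))))%C = RtoC (- (ln (INR (S n)) + ln (INR (S n)))).
    by move: (ln _) => l; apply: injective_projections => /=; ring.
  move: (INR _) Hn => x Hx; rewrite /Cexp [Re _]/= [Im _]/=.
  rewrite sin_0 cos_0 exp_Ropp exp_plus exp_ln // Rmult_0_r Rmult_1_r.
  by rewrite /RtoC /= Rmult_1_r.
rewrite /zeta /CSeries /RtoC; congr (_, _).
  by apply: Series_ext => n; rewrite Hterm.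
rewrite (Series_ext _ (fun n => 0 * 0)); first by rewrite Series_scal_l Rmult_0_l.
by move=> n; rewrite Hterm /=; ring.
Qed.

(** The factor 1 - p^k from the difference cancels the one in the denominator; index 0 drops out by
    its default value. *)
Lemma qdilog_sub (p : R) : 0 < p < 1 ->
  qdilog p 1 - qdilog p p = Series (fun n => / (INR (S n) ^ 2)).
Proof.
move=> Hp.
have Hex1 : ex_series (fun k => qdilog_coef p k * 1 ^ k).
  apply: ex_series_ext (ex_series_Rabs _ (ex_series_qdilog_coef p Hp)) => k.
  by rewrite pow1 Rmult_1_r.
have Hexp : ex_series (fun k => qdilog_coef p k * p ^ k).
  apply: ex_series_Rabs; apply: CV_disk_inside; apply: qdilog_CV_radius => //.
  by rewrite Rabs_pos_eq; lra.
rewrite /qdilog /PSeries -Series_minus // Series_incr_1; last first.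
  exact: (ex_series_minus (V := R_NormedModule)) Hex1 Hexp.
rewrite qdilog_coef_0 !Rmult_0_l Rminus_0_r Rplus_0_l; apply: Series_ext => n.
have H1 : 0 < INR (S n) by apply: lt_0_INR; lia.
have H2 := pow_lt_1 p n Hp.
by rewrite /qdilog_coef pow1; field; lra.
Qed.

Lemma theta4_term_re (t q : R) (n : Z) :
  Re (theta4_term (Ci * RtoC t)%C q n)
    = powerRZ (-1) n * powerRZ q (n * n) * exp (- 2 * IZR n * t).
Proof.
rewrite /theta4_term /Cexp; set z := Cmult _ (Cmult Ci _).
have -> : Im z = 0 by rewrite /Im /z /=; ring.
have -> : Re z = - 2 * IZR n * t by rewrite /Re /z /=; ring.
by rewrite cos_0 sin_0 /Re /=; ring.
Qed.

Lemma theta4_imaginary (q t : R) : 0 < q < 1 ->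
  q * exp (- 2 * t) < 1 -> q / exp (- 2 * t) < 1 ->
  Re (theta4 (Ci * RtoC t)%C q)
    = exp (qln (q ^ 2) (q ^ 2) + qln (q ^ 2) (q * exp (- 2 * t))
        + qln (q ^ 2) (q / exp (- 2 * t))).
Proof.
move=> Hq H1 H2; have Hz := exp_pos (- 2 * t).
rewrite -(jacobi_triple_product q Hq _ Hz H1 H2).
set z := exp _ in Hz H1 H2 *.
have Hexp n : exp (- 2 * INR n * t) = z ^ n.
  elim: n => [|n IHn]; first by rewrite /= Rmult_0_r Rmult_0_l exp_0.
  by rewrite S_INR [z ^ S n]/= -IHn /z -exp_plus; congr exp; ring.
have Hqq n : powerRZ q (Z.of_nat n * Z.of_nat n) = q ^ (n * n.-1) * q ^ n.
  rewrite -Znat.Nat2Z.inj_mul -pow_powerRZ -pow_add; congr (_ ^ _); case: n => [|n]; nia.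
have Hpos n : Re (theta4_term (Ci * RtoC t)%C q (Z.of_nat n)) = theta_term q (q * z) n.
  rewrite theta4_term_re -INR_IZR_INZ Hexp Hqq -pow_powerRZ.
  by rewrite /theta_term Rpow_mult_distr; ring.
have Hneg n : Re (theta4_term (Ci * RtoC t)%C q (- Z.of_nat (S n))%Z)
    = theta_term q (q / z) (S n).
  rewrite theta4_term_re BinInt.Z.mul_opp_opp Hqq opp_IZR -INR_IZR_INZ.
  have -> : - 2 * - INR (S n) * t = - (- 2 * INR (S n) * t) by ring.
  rewrite exp_Ropp Hexp powerRZ_neg -?pow_powerRZ; last by lra.
  rewrite /theta_term /Rdiv Rpow_mult_distr pow_inv -pow_inv.
  have -> : / -1 = -1 by field.
  by rewrite pow_inv; ring.
have -> : Re (theta4 (Ci * RtoC t)%C q)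
    = Series (theta_term q (q * z)) + Series (fun n => theta_term q (q / z) (S n)).
  by rewrite -(Series_ext _ _ Hpos) -(Series_ext _ _ Hneg).
(* The negative half of theta starts at n = -1, so restoring the index 0 term, equal to 1, accounts
   for the [- 1] of the triple product. *)
rewrite (Series_incr_1 (theta_term q (q / z))); last first.
  apply: ex_series_theta_term => //; split => //.
  by apply: Rmult_le_pos; [lra|apply: Rlt_le; exact: Rinv_0_lt_compat].
have -> : theta_term q (q / z) 0 = 1 by rewrite /theta_term /=; ring.
ring.
Qed.

Section LogThetaPrimitive.

Variable q : R.
Hypothesis Hq : 0 < q < 1.

Local Notation p := (q ^ 2).

Let Hp : 0 < p < 1.
Proof. by split; [apply: pow_lt; lra|rewrite /=; nra]. Qed.

Let Hln : ln q < 0.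
Proof. by rewrite -ln_1; apply: ln_increasing; lra. Qed.

(** The real power p^s, as p = q^2. *)
Let E (s : R) : R := exp (2 * s * ln q).

Let E_bounds (s : R) : 0 < s -> 0 < E s < 1.
Proof.
move=> Hs; split; first exact: exp_pos.
by rewrite /E -exp_0; apply: exp_increasing; nra.
Qed.

Let E_1 : E 1 = p.
Proof.
have -> : p = exp (ln q) * exp (ln q) by rewrite exp_ln; [ring|lra].
by rewrite -exp_plus /E; congr exp; ring.
Qed.

Let is_derive_qdilog_E (s : R) : 0 < s ->
  is_derive (fun s => qdilog p (E s)) s (- (2 * ln q * qln p (E s))).
Proof.
move=> Hs; have HE := E_bounds s Hs.
have D1 : is_derive (qdilog p) (E s) (- qln p (E s) / E s).
  by apply: (is_derive_qdilog p Hp); [rewrite Rabs_pos_eq; lra|lra].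
have D2 : is_derive E s (2 * ln q * E s).
  by rewrite /E; auto_derive => //; ring.
have -> : - (2 * ln q * qln p (E s)) = scal (2 * ln q * E s) (- qln p (E s) / E s).
  by rewrite /scal /= /mult /=; field; lra.
exact: (is_derive_comp (qdilog p) E).
Qed.

Let continuous_E (s : R) : continuous E s.
Proof.
by apply: (ex_derive_continuous (V := R_NormedModule)); rewrite /E; auto_derive.
Qed.

(* log theta_4 at the parameter s of the segment. *)
Definition ln_theta (s : R) : R :=
  qln p p + qln p (exp (2 * s * ln q)) + qln p (exp (2 * (1 - s) * ln q)).

(** The divisor 2 ln q is ln p. The two [qdilog] terms have opposite signs because s -> 1 - s
    reverses the derivative. *)
Definition ln_theta_primitive (s : R) : R :=
  s * qln p p + (qdilog p (exp (2 * (1 - s) * ln q)) - qdilog p (exp (2 * s * ln q)))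
    / (2 * ln q).

Lemma is_derive_ln_theta_primitive (s : R) : 0 < s < 1 ->
  is_derive ln_theta_primitive s (ln_theta s).
Proof.
move=> Hs.
have D1 : is_derive (fun s => qdilog p (E s)) s (- (2 * ln q * qln p (E s))).
  by apply: is_derive_qdilog_E; lra.
have D2 : is_derive (fun s => qdilog p (E (1 - s))) s (2 * ln q * qln p (E (1 - s))).
  have D3 : is_derive (fun s => qdilog p (E s)) (1 - s) (- (2 * ln q * qln p (E (1 - s)))).
    by apply: is_derive_qdilog_E; lra.
  have D4 : is_derive (fun s => 1 - s) s (-1) by auto_derive => //; ring.
  have -> : 2 * ln q * qln p (E (1 - s)) = scal (-1) (- (2 * ln q * qln p (E (1 - s)))).
    by rewrite /scal /= /mult /=; ring.
  exact: (is_derive_comp (fun s => qdilog p (E s)) (fun s => 1 - s)).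
have D5 : is_derive (fun s => s * qln p p) s (qln p p).
  by move: (qln _ _) => c; auto_derive => //; ring.
have D6 := is_derive_scal_l _ _ _ (/ (2 * ln q)) (is_derive_minus _ _ _ _ _ D2 D1).
have D7 := is_derive_plus _ _ _ _ _ D5 D6.
have -> : ln_theta s = plus (qln p p) (scal (minus (2 * ln q * qln p (E (1 - s)))
    (- (2 * ln q * qln p (E s)))) (/ (2 * ln q))).
  rewrite /ln_theta /plus /minus /scal /opp /= /plus /mult /= -/(E s) -/(E (1 - s)).
  by field; lra.
exact: D7.
Qed.

Lemma continuous_ln_theta (s : R) : 0 < s < 1 -> continuous ln_theta s.
Proof.
move=> Hs.
have HC u : 0 < u -> continuous (fun s => qln p (E s)) u.
  move=> Hu; apply: continuous_comp; first exact: continuous_E.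
  by apply: (continuous_qln p Hp); have := E_bounds u Hu; move=> ?; rewrite Rabs_pos_eq; lra.
apply: (continuous_plus (V := R_NormedModule)).
  apply: (continuous_plus (V := R_NormedModule)); first exact: continuous_const.
  by apply: HC; lra.
apply: (continuous_comp (fun s => 1 - s) (fun s => qln p (E s))); last by apply: HC; lra.
apply: (continuous_minus (V := R_NormedModule)); first exact: continuous_const.
exact: continuous_id.
Qed.

(** For s > 0 the argument [E s] approaches 1 from below, the side on which the limit of [qdilog] is
    available. *)
Let filterlim_qdilog_E_0 :
  filterlim (fun s => qdilog p (E s)) (at_right 0) (locally (qdilog p 1)).
Proof.
apply: (filterlim_comp _ _ _ E (qdilog p) _ (at_left 1)); last first.
  by apply: PSeries_left_continuous_1; exact: ex_series_qdilog_coef.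
have HE0 : E 0 = 1 by rewrite /E Rmult_0_r Rmult_0_l exp_0.
move=> P [eps HP]; have HE : locally (E 0) (ball 1 eps) by rewrite HE0; exists eps.
have [d Hd] := continuous_E 0 _ HE; exists d => s Hs Hs0.
by apply: HP; [exact: Hd|have := E_bounds s Hs0; lra].
Qed.

(** The map [g] is the identity at the end s = 1 and s -> 1 - s at the end s = 0. *)
Let filterlim_qdilog_E_1 (F : (R -> Prop) -> Prop) {FF : Filter F} (g : R -> R) :
  filterlim g F (locally 1) ->
  filterlim (fun s => qdilog p (E (g s))) F (locally (qdilog p p)).
Proof.
move=> Hg; apply: (filterlim_comp _ _ _ g (fun s => qdilog p (E s)) _ _ _ Hg).
have H : continuous (fun s => qdilog p (E s)) 1.
  apply: (ex_derive_continuous (V := R_NormedModule)).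
  by eexists; apply: is_derive_qdilog_E; lra.
by move: H; rewrite /continuous E_1.
Qed.

Let filterlim_1_minus (x : R) : filterlim (fun s => 1 - s) (locally x) (locally (1 - x)).
Proof.
have H : continuous (fun s => 1 - s) x.
  by apply: (ex_derive_continuous (V := R_NormedModule)); auto_derive.
exact: H.
Qed.

Let filterlim_primitive (F : (R -> Prop) -> Prop) {FF : Filter F} (x a b : R) :
  filterlim (fun s => s) F (locally x) ->
  filterlim (fun s => qdilog p (E (1 - s))) F (locally a) ->
  filterlim (fun s => qdilog p (E s)) F (locally b) ->
  filterlim ln_theta_primitive F (locally (x * qln p p + (a - b) / (2 * ln q))).
Proof.
move=> Hx Ha Hb.
have Hb' := filterlim_comp _ _ _ _ _ _ _ _ Hb (filterlim_opp (V := R_NormedModule) b).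
have Hab := filterlim_comp_2 (FF := FF) _ _ _ Ha Hb' (filterlim_plus (V := R_NormedModule) a (- b)).
have Hab' := filterlim_comp _ _ _ _ _ _ _ _ Hab
  (filterlim_scal_l (V := R_NormedModule) (a - b) (/ (2 * ln q))).
have Hx' := filterlim_comp _ _ _ _ _ _ _ _ Hx
  (filterlim_scal_l (V := R_NormedModule) x (qln p p)).
exact: (filterlim_comp_2 (FF := FF) _ _ _ Hx' Hab'
  (filterlim_plus (V := R_NormedModule) (x * qln p p) ((a - b) / (2 * ln q)))).
Qed.

Lemma filterlim_ln_theta_primitive_0 : filterlim ln_theta_primitive (at_right 0)
  (locally ((qdilog p p - qdilog p 1) / (2 * ln q))).
Proof.
have -> : (qdilog p p - qdilog p 1) / (2 * ln q)
    = 0 * qln p p + (qdilog p p - qdilog p 1) / (2 * ln q) by rewrite Rmult_0_l Rplus_0_l.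
have Hle : filterlim (fun s => s) (at_right 0) (locally 0) by exact: filter_le_within.
apply: (filterlim_primitive (at_right 0)) => //.
apply: (filterlim_qdilog_E_1 _ (fun s => 1 - s)).
rewrite -[X in locally X](Rminus_0_r 1).
exact: filterlim_comp Hle (filterlim_1_minus 0).
Qed.

Lemma filterlim_ln_theta_primitive_1 : filterlim ln_theta_primitive (at_left 1)
  (locally (qln p p + (qdilog p 1 - qdilog p p) / (2 * ln q))).
Proof.
have -> : qln p p + (qdilog p 1 - qdilog p p) / (2 * ln q)
    = 1 * qln p p + (qdilog p 1 - qdilog p p) / (2 * ln q) by rewrite Rmult_1_l.
have Hle : filterlim (fun s => s) (at_left 1) (locally 1) by exact: filter_le_within.
apply: (filterlim_primitive (at_left 1)) => //; last exact: (filterlim_qdilog_E_1 _ (fun s => s)).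
apply: (filterlim_comp _ _ _ (fun s => 1 - s) (fun s => qdilog p (E s))
  _ _ _ _ filterlim_qdilog_E_0).
move=> P [eps HP]; exists eps => s Hs Hs1; apply: HP; last by lra.
move: Hs; rewrite /ball /= /AbsRing_ball /= /abs /minus /plus /opp /=.
by split_Rabs; lra.
Qed.

Lemma is_RInt_ln_theta (a b : R) : 0 < a < 1 -> 0 < b < 1 ->
  is_RInt ln_theta a b (ln_theta_primitive b - ln_theta_primitive a).
Proof.
move=> Ha Hb.
have Hab x : Rmin a b <= x <= Rmax a b -> 0 < x < 1.
  by rewrite /Rmin /Rmax; case: Rle_dec => ?; lra.
apply: (is_RInt_derive (V := R_CompleteNormedModule)) => x /Hab Hx.
  exact: is_derive_ln_theta_primitive.
exact: continuous_ln_theta.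
Qed.

Lemma ln_theta4_segment (s : R) : 0 < s < 1 ->
  let xstar : C := (RtoC (1 / 2)%R * Ci * RtoC (ln q))%C in
  ln (Re (theta4 (- xstar + RtoC s * (xstar - - xstar))%C q)) = ln_theta s.
Proof.
move=> Hs xstar.
(* The point is i t with t = (s - 1/2) ln q, so z = e^(-2t) = q^(1-2s). *)
have -> : (- xstar + RtoC s * (xstar - - xstar))%C = (Ci * RtoC ((2 * s - 1) / 2 * ln q))%C.
  by rewrite /xstar; apply: injective_projections => /=; field.
have Hq1 : q * exp (- 2 * ((2 * s - 1) / 2 * ln q)) = E (1 - s).
  rewrite -[X in X * _](exp_ln q); last by lra.
  by rewrite -exp_plus /E; congr exp; field.
have Hq2 : q / exp (- 2 * ((2 * s - 1) / 2 * ln q)) = E s.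
  rewrite -[X in X / _](exp_ln q); last by lra.
  by rewrite [LHS]/Rdiv -exp_Ropp -exp_plus /E; congr exp; field.
rewrite theta4_imaginary // ?Hq1 ?Hq2.
- by rewrite ln_exp /ln_theta -/(E s) -/(E (1 - s)); ring.
- by have := E_bounds (1 - s); lra.
- by have := E_bounds s; lra.
Qed.

End LogThetaPrimitive.

Lemma filterlim_scal_increment (f : R -> R) (Fa Fb : (R -> Prop) -> Prop)
    {FFa : Filter Fa} {FFb : Filter Fb} (c la lb : R) :
  filterlim f Fa (locally la) -> filterlim f Fb (locally lb) ->
  filterlim (fun ab => c * (f ab.2 - f ab.1)) (filter_prod Fa Fb) (locally (c * (lb - la))).
Proof.
move=> Ha Hb.
have H2 : filterlim (fun ab => f ab.2) (filter_prod Fa Fb) (locally lb).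
  exact: filterlim_comp filterlim_snd Hb.
have H1 : filterlim (fun ab => opp (f ab.1)) (filter_prod Fa Fb) (locally (opp la)).
  apply: filterlim_comp (filterlim_opp (V := R_NormedModule) la).
  exact: filterlim_comp filterlim_fst Ha.
apply: filterlim_comp (filterlim_scal_r (V := R_NormedModule) c (lb - la)).
exact: (filterlim_comp_2 _ _ _ H2 H1 (filterlim_plus (V := R_NormedModule) lb (- la))).
Qed.

Theorem mainTheorem1 (q : R) (hq : 0 < q < 1) :
  let xstar : C := (RtoC (1 / 2)%R * Ci * RtoC (ln q))%C in
  is_segment_integral (fun x : C => RtoC (ln (Re (theta4 x q))))
    (- xstar)%C xstar
    (Ci * (zeta (RtoC 2)
           - RtoC (ln q) * RtoC (ln (Series (fun n : nat => (INR (P n) * q ^ (2 * n))%R)))))%C.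
Proof.
move=> xstar.
have Hp : 0 < q ^ 2 < 1 by split; [apply: pow_lt; lra|rewrite /=; nra].
have Hln : ln q < 0 by rewrite -ln_1; apply: ln_increasing; lra.
rewrite zeta_2 -(qdilog_sub (q ^ 2) Hp).
rewrite (Series_ext _ (fun n => INR (P n) * (q ^ 2) ^ n)); last by move=> n; rewrite -pow_mult.
rewrite (ln_Series_P (q ^ 2) Hp).
set p := q ^ 2 in Hp *.
set v := qdilog p 1 - qdilog p p + ln q * qln p p.
have -> : (Ci * (RtoC (qdilog p 1 - qdilog p p) - RtoC (ln q) * RtoC (- qln p p)))%C = (0, v).
  by rewrite /v; apply: injective_projections => /=; ring.
have Hlim : filterlim
    (fun ab : R * R => ln q * (ln_theta_primitive q ab.2 - ln_theta_primitive q ab.1))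
    (filter_prod (at_right 0) (at_left 1)) (locally v).
  (* The factor [ln q] comes from dx = i ln q ds; the end limits differ by twice the same [qdilog]
     increment, which cancels the 2 in 2 ln q. *)
  have -> : v = ln q * ((qln p p + (qdilog p 1 - qdilog p p) / (2 * ln q))
      - (qdilog p p - qdilog p 1) / (2 * ln q)) by rewrite /v; field; lra.
  apply: filterlim_scal_increment.
    exact: filterlim_ln_theta_primitive_0.
  exact: filterlim_ln_theta_primitive_1.
rewrite /is_segment_integral /is_RInt_gen.
apply: (filterlimi_lim_ext_loc
  (fun ab => (0, ln q * (ln_theta_primitive q ab.2 - ln_theta_primitive q ab.1)) : C)).
  apply: (Filter_prod _ _ _ (fun a => 0 < a < 1) (fun b => 0 < b < 1)).
  - exists (mkposreal 1 Rlt_0_1) => a Ha Ha0; split => //.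
    by move: Ha; rewrite /ball /= /AbsRing_ball /= /abs /minus /plus /opp /=; split_Rabs; lra.
  - exists (mkposreal 1 Rlt_0_1) => b Hb Hb1; split => //.
    by move: Hb; rewrite /ball /= /AbsRing_ball /= /abs /minus /plus /opp /=; split_Rabs; lra.
  move=> a b Ha Hb /=.
  (* The integrand is purely imaginary, so it is integrated componentwise with real part 0. *)
  apply: (is_RInt_ext (V := C_R_NormedModule) (fun s => (0, ln q * ln_theta q s) : C)).
    move=> s Hs.
    have Hs01 : 0 < s < 1 by move: Hs; rewrite /Rmin /Rmax; case: Rle_dec => ?; lra.
    rewrite (ln_theta4_segment q hq s Hs01).
    by rewrite /xstar; apply: injective_projections => /=; field.
  apply: (is_RInt_fct_extend_pair (U := R_NormedModule) (V := R_NormedModule)) => /=.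
    have := is_RInt_const (V := R_NormedModule) a b 0.
    by rewrite /scal /= /mult /= Rmult_0_r.
  apply: (is_RInt_scal (V := R_NormedModule)).
  exact: is_RInt_ln_theta.
apply/filterlim_locally => eps.
have FF : Filter (filter_prod (at_right 0) (at_left 1)) by exact: filter_prod_filter.
apply: filter_imp (proj1 (filterlim_locally (FF := FF) _ _) Hlim eps) => ab Hab.
by split; [exact: ball_center|exact: Hab].
Qed.
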